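(* Let $f$ be a complex-valued function satisfying: (a) $f(z)$ is analytic for $|z|<1$; (b) $|f(z)|<1$ for $|z|<1$; (c) $f(0)=0$; (d) for some $b\in\mathbb{C}$ with $|b|=1$, $f$ extends continuously to $b$, $|f(b)|=1$, and $f'(b)$ exists. Then $$|f'(b)|\geq 1,$$ and moreover $|f'(b)|>1$ unless there is a real number $\alpha$ such that $f(z)=e^{i\alpha}z$ for all $|z|<1$.
   Context: ''$f$ extends continuously to $b$'' means that $f(z)$ has a limit as $z\to b$ with $|z|<1$; this limit is denoted $f(b)$. ''$f'(b)$ exists'' means that the limit $f'(b)=\lim_{z\to b,\ |z|<1}\frac{f(z)-f(b)}{z-b}$ exists in $\mathbb{C}$. *)

(* Defs.v *)
From Stdlib Require Import Reals.
From Coquelicot Require Import Coquelicot.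

Open Scope R_scope.

Definition unit_disc (z : C) : Prop := Cmod z < 1.

(** [@ex_derive C_AbsRing C_NormedModule] is differentiability over the field
    of complex numbers, not over [R].  On an open set [D] this only depends on
    the values of [f] on [D]. *)
Definition analytic_on (D : C -> Prop) (f : C -> C) : Prop :=
  forall z : C, D z -> @ex_derive C_AbsRing C_NormedModule f z.

(** Limits at [b] are taken along [|z| < 1] only, so the value of the total
    function [f] at a point [b] of the unit circle plays no role. *)
Definition is_lim_disc (f : C -> C) (b l : C) : Prop :=
  filterlim f (within unit_disc (@locally C_UniformSpace b))
              (@locally C_UniformSpace l).

(** [fb] stands for the boundary value, i.e. the limit of [f] at [b]; for
    [|b| = 1] the denominator does not vanish on the disc. *)
Definition is_derive_disc (f : C -> C) (b fb d : C) : Prop :=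
  is_lim_disc (fun z : C => (f z - fb) / (z - b))%C b d.

(** e^(x + iy) = e^x (cos y + i sin y). *)
Definition Cexp (z : C) : C :=
  (exp (Re z) * cos (Im z), exp (Re z) * sin (Im z)).

(* Main.v *)
Require Import Defs.
From Stdlib Require Import Reals Lra Classical ClassicalEpsilon.
From Coquelicot Require Import Coquelicot.

Open Scope R_scope.

(** Put [g z = f z / z]. Schwarz's lemma gives [|g| <= 1], and unless [f] is a
    rotation [|g|] is bounded away from [1] on the circle [|z| = 1/4]. As in
    Hopf's boundary lemma, comparison with the subharmonic barrier
    [eps / |z|^2] on [1/4 <= |z| < 1] then yields [|g z| <= 1 - eps (1 - |z|)],
    so the difference quotients of [f] along the radius to [b] have modulus at
    least [1 + eps |z|].

    The maximum principles come from Goursat's theorem for rectangles in the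
    coordinate [log (z - z0)], which also covers a centre [z0] where the
    function is only known to be continuous; hence the singularity of [g] at
    [0] need not be removed. *)

(** * Bisection and extreme values in the plane *)

(** Real parts of holomorphic functions satisfy the mean value identity, moduli do not. Each bound
    on [Cmod (g z1)] is therefore proved for one point at a time, after multiplying [g] by a
    unimodular constant that makes its value there real and nonnegative. The mean value argument
    only shows constancy on a disc centred at the maximum; to reach the boundary from it would take
    a connectedness argument. Adding a strictly subharmonic term avoids this, as the sum has no
    interior maximum at all. With the term written [eps * |phi|^2] for an injective holomorphic
    [phi], one lemma serves twice: [phi z = z], with a coefficient tending to 0, gives Schwarz's
    lemma, and [phi z = / z] gives the Hopf estimate. Nothing is known about [g] on [|z| = 1], so
    each comparison is made on [|z| <= r] with [r < 1], and [r] then tends to 1. The radius 1/4 is a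
    choice below 1/2: for [|z0| < 1/2] the disc of radius [|z0|] about [z0] lies in the unit disc,
    as the rigidity argument requires. *)

Lemma functional_choice (A B : Type) (R : A -> B -> Prop) :
  (forall a, exists b, R a b) -> exists f : A -> B, forall a, R a (f a).
Proof.
  intros H. exists (fun a => proj1_sig (constructive_indefinite_description _ (H a))).
  intros a. apply proj2_sig.
Qed.

(** Common core of the extreme value theorem and of Goursat's theorem: choosing a quarter that keeps
    [P] again and again gives nested rectangles, similar to the first one, that shrink to a point
    [(a, b)]. *)
Lemma bisection_limit (P : R -> R -> R -> R -> Prop) (x0 y0 w h : R) :
  0 <= w -> 0 <= h -> P x0 y0 w h ->
  (forall x y w h : R, P x y (2 * w) (2 * h) ->
     P x y w h \/ P (x + w) y w h \/ P x (y + h) w h \/ P (x + w) (y + h) w h) ->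
  exists a b : R, forall delta : R, 0 < delta ->
    exists x y k : R, 0 < k /\ k * w < delta /\ k * h < delta /\
      P x y (k * w) (k * h) /\ x <= a <= x + k * w /\ y <= b <= y + k * h.
Proof.
  intros Hw Hh H0 Hstep.
  set (k := fun n : nat => / 2 ^ n).
  assert (Hk : forall n, 0 < k n) by (intros n; apply Rinv_0_lt_compat, pow_lt; lra).
  assert (HkS : forall n, k n = 2 * k (S n)).
  { intros n. unfold k. simpl. field. apply pow_nonzero. lra. }
  set (Q := fun (n : nat) (p : R * R) => P (fst p) (snd p) (k n * w) (k n * h)).
  (* [Q] is a premise under the existential, so that choice yields a total step function; a state
     violating [Q] may be sent anywhere. *)
  assert (Hnext : forall np : nat * (R * R), exists np' : nat * (R * R),
      Q (fst np) (snd np) ->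
      fst np' = S (fst np) /\ Q (S (fst np)) (snd np') /\
      fst (snd np) <= fst (snd np') <= fst (snd np) + k (S (fst np)) * w /\
      snd (snd np) <= snd (snd np') <= snd (snd np) + k (S (fst np)) * h).
  { intros [n [x y]].
    destruct (classic (Q n (x, y))) as [HQ | HQ].
    2: { exists (n, (x, y)). intros HQ'. contradiction. }
    assert (Hw' := Rmult_le_pos _ _ (Rlt_le _ _ (Hk (S n))) Hw).
    assert (Hh' := Rmult_le_pos _ _ (Rlt_le _ _ (Hk (S n))) Hh).
    unfold Q in HQ; simpl in HQ. rewrite HkS, !Rmult_assoc in HQ.
    destruct (Hstep _ _ _ _ HQ) as [H | [H | [H | H]]];
      [ exists (S n, (x, y)) | exists (S n, (x + k (S n) * w, y))
      | exists (S n, (x, y + k (S n) * h))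
      | exists (S n, (x + k (S n) * w, y + k (S n) * h)) ];
      intros _; unfold Q; cbn [fst snd]; repeat split; try assumption; lra. }
  apply functional_choice in Hnext. destruct Hnext as [nx Hnx].
  set (s := fix s (n : nat) := match n with O => (O, (x0, y0)) | S n => nx (s n) end).
  assert (Hs : forall n, fst (s n) = n /\ Q n (snd (s n))).
  { induction n as [| n [IH1 IH2]].
    - split; [reflexivity |]. unfold Q, k. simpl. now rewrite Rinv_1, !Rmult_1_l.
    - rewrite <- IH1 in IH2 at 1. destruct (Hnx _ IH2) as (E & HQ & _).
      change (s (S n)) with (nx (s n)). rewrite IH1 in E, HQ. now rewrite E. }
  assert (Hs1 : forall n,
      fst (snd (s n)) <= fst (snd (s (S n))) <= fst (snd (s n)) + k (S n) * w /\
      snd (snd (s n)) <= snd (snd (s (S n))) <= snd (snd (s n)) + k (S n) * h).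
  { intros n. destruct (Hs n) as [E HQ]. rewrite <- E in HQ at 1.
    destruct (Hnx _ HQ) as (_ & _ & H). now rewrite E in H. }
  assert (Hlim : forall (u : nat -> R) (c : R), 0 <= c ->
      (forall n, u n <= u (S n) <= u n + k (S n) * c) ->
      exists a, forall n, u n <= a <= u n + k n * c).
  { intros u c Hc Hu.
    (* Nested intervals: the left ends increase, and the right ends [u n + k n * c] decrease because
       [k n = 2 * k (S n)]. *)
    assert (Hd : forall n m, u n <= u (n + m)%nat /\
                            u (n + m)%nat + k (n + m)%nat * c <= u n + k n * c).
    { intros n m. induction m as [| m IH].
      - rewrite Nat.add_0_r. lra.
      - rewrite Nat.add_succ_r. specialize (Hu (n + m)%nat).
        rewrite (HkS (n + m)%nat) in IH. lra. }
    destruct (ex_finite_lim_seq_incr u (u 0%nat + c)) as [a Ha].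
    - intros n. apply Hu.
    - intros n. destruct (Hd 0%nat n) as [_ H]. simpl in H.
      assert (0 <= k n * c) by (apply Rmult_le_pos; [apply Rlt_le, Hk | exact Hc]).
      unfold k in H at 2. simpl in H. rewrite Rinv_1 in H. lra.
    - exists a. intros n. split.
      + apply (is_lim_seq_incr_compare u a Ha). intros m. apply Hu.
      + change (Rbar_le (Finite a) (Finite (u n + k n * c))).
        apply (is_lim_seq_le (fun m => u (m + n)%nat) (fun _ => u n + k n * c)).
        * intros m. destruct (Hd n m) as [_ H]. rewrite (Nat.add_comm m n).
          assert (0 <= k (n + m)%nat * c)
            by (apply Rmult_le_pos; [apply Rlt_le, Hk | exact Hc]). lra.
        * now apply is_lim_seq_incr_n.
        * apply is_lim_seq_const. }
  destruct (Hlim (fun n => fst (snd (s n))) w Hw) as [a Ha]; [apply Hs1 |].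
  destruct (Hlim (fun n => snd (snd (s n))) h Hh) as [b Hb]; [apply Hs1 |].
  exists a, b. intros delta Hdelta.
  assert (Hkl : is_lim_seq k 0).
  { apply is_lim_seq_ext with (fun n => (/ 2) ^ n).
    - intros n. unfold k. now rewrite pow_inv.
    - apply is_lim_seq_geom. rewrite Rabs_pos_eq; lra. }
  assert (Hd' : 0 < delta / (w + h + 1)) by (apply Rdiv_lt_0_compat; lra).
  apply is_lim_seq_spec in Hkl. destruct (Hkl (mkposreal _ Hd')) as [n Hn].
  specialize (Hn n (Nat.le_refl n)). simpl in Hn.
  rewrite Rminus_0_r, Rabs_pos_eq in Hn by apply Rlt_le, Hk.
  apply (Rmult_lt_compat_r (w + h + 1)) in Hn; [| lra].
  replace (delta / (w + h + 1) * (w + h + 1)) with delta in Hn by (field; lra).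
  exists (fst (snd (s n))), (snd (snd (s n))), (k n).
  assert (0 < k n) by apply Hk.
  assert (0 <= k n * w) by (apply Rmult_le_pos; lra).
  assert (0 <= k n * h) by (apply Rmult_le_pos; lra).
  destruct (Hs n) as [_ HQ].
  repeat split; try assumption; try apply Ha; try apply Hb; lra.
Qed.

Lemma locally_Cmod (z : C) (P : C -> Prop) :
  @locally C_UniformSpace z P <->
  exists delta : R, 0 < delta /\ forall w : C, Cmod (w - z) < delta -> P w.
Proof.
  split.
  - intros H. apply locally_C in H. destruct H as [d Hd].
    exists d. split; [apply cond_pos |]. intros w Hw. apply Hd. exact Hw.
  - intros (d & Hd & H). apply locally_C. exists (mkposreal d Hd).
    intros w Hw. apply H. exact Hw.
Qed.

Lemma continuous_Cmod_R (u : C -> R) (z : C) :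
  @continuous C_UniformSpace R_UniformSpace u z <->
  forall eps : R, 0 < eps -> exists delta : R, 0 < delta /\
    forall w : C, Cmod (w - z) < delta -> Rabs (u w - u z) < eps.
Proof.
  split.
  - intros H eps Heps. apply locally_Cmod.
    apply (H (fun y => Rabs (y - u z) < eps)).
    exists (mkposreal eps Heps). intros y Hy. exact Hy.
  - intros H P [eps HP]. destruct (H eps (cond_pos eps)) as (d & Hd & Hw).
    apply locally_Cmod. exists d. split; [exact Hd |].
    intros w Hw'. apply HP. apply (Hw w Hw').
Qed.

Lemma continuous_Cmod_C (f : C -> C) (z : C) :
  @continuous C_UniformSpace C_UniformSpace f z <->
  forall eps : R, 0 < eps -> exists delta : R, 0 < delta /\
    forall w : C, Cmod (w - z) < delta -> Cmod (f w - f z) < eps.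
Proof.
  split.
  - intros H eps Heps. apply locally_Cmod.
    apply (H (fun y => Cmod (y - f z) < eps)).
    apply locally_Cmod. exists eps. now split.
  - intros H P HP. apply locally_Cmod in HP. destruct HP as (eps & Heps & HP).
    destruct (H eps Heps) as (d & Hd & Hw).
    apply locally_Cmod. exists d. split; [exact Hd |].
    intros w Hw'. apply HP. apply (Hw w Hw').
Qed.

Lemma is_derive_Cmod (f : C -> C) (z l : C) :
  @is_derive C_AbsRing C_NormedModule f z l <->
  forall eps : R, 0 < eps -> exists delta : R, 0 < delta /\
    forall w : C, Cmod (w - z) < delta ->
      Cmod (f w - f z - (w - z) * l)%C <= eps * Cmod (w - z).
Proof.
  split.
  - intros [_ H] eps Heps. specialize (H z (fun P HP => HP) (mkposreal eps Heps)).
    destruct H as [d Hd]. exists d. split; [apply cond_pos |]. intros w Hw. exact (Hd w Hw).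
  - intros H. split.
    + apply @is_linear_scal_l.
    + intros x Hx. apply @is_filter_lim_locally_unique in Hx. subst x.
      intros eps. destruct (H eps (cond_pos eps)) as (d & Hd & Hw).
      exists (mkposreal d Hd). intros w Hw'. exact (Hw w Hw').
Qed.

(** Bisection keeps a rectangle in which every value of [u] on [E] is matched or exceeded. The limit
    point is in [E] by closedness, and a larger value elsewhere would contradict continuity
    there. *)
Lemma extreme_value_C (E : C -> Prop) (M : R) (u : C -> R) (z1 : C) :
  @closed C_UniformSpace E -> (forall z, E z -> Cmod z <= M) ->
  (forall z, E z -> @continuous C_UniformSpace R_UniformSpace u z) -> E z1 ->
  exists z0, E z0 /\ forall z, E z -> u z <= u z0.
Proof.
  intros HE HM Hu Hz1.
  assert (HM0 : 0 <= M) by (eapply Rle_trans; [apply Cmod_ge_0 | now apply (HM z1)]).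
  set (P := fun x y w h => forall z, E z -> exists z', E z' /\ u z <= u z' /\
              x <= fst z' <= x + w /\ y <= snd z' <= y + h).
  destruct (bisection_limit P (- M) (- M) (2 * M) (2 * M)) as (a & b & Hab); [lra | lra | | |].
  - intros z Hz. exists z. specialize (HM z Hz).
    assert (H := Rmax_Cmod z).
    assert (H1 := Rmax_l (Rabs (fst z)) (Rabs (snd z))).
    assert (H2 := Rmax_r (Rabs (fst z)) (Rabs (snd z))).
    assert (H3 : Rabs (fst z) <= M) by lra. assert (H4 : Rabs (snd z) <= M) by lra.
    apply Rabs_le_between in H3, H4. repeat split; try assumption; lra.
  - intros x y w h HP. apply NNPP. intros HN.
    apply not_or_and in HN. destruct HN as [N1 HN].
    apply not_or_and in HN. destruct HN as [N2 HN].
    apply not_or_and in HN. destruct HN as [N3 N4].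
    (* If all four quarters fail, each has a point of [E] that it cannot match. The best of these
       four is matched in the large rectangle, hence in one of the quarters, a contradiction. *)
    assert (Hmax : forall p q : C, E p -> E q -> exists r, E r /\ u p <= u r /\ u q <= u r).
    { intros p q Hp Hq. destruct (Rle_dec (u p) (u q)); [exists q | exists p];
        repeat split; try assumption; lra. }
    apply not_all_ex_not in N1, N2, N3, N4.
    destruct N1 as [p1 N1], N2 as [p2 N2], N3 as [p3 N3], N4 as [p4 N4].
    apply imply_to_and in N1, N2, N3, N4.
    destruct N1 as [E1 N1], N2 as [E2 N2], N3 as [E3 N3], N4 as [E4 N4].
    destruct (Hmax p1 p2 E1 E2) as (q1 & Eq1 & L1 & L2).
    destruct (Hmax p3 p4 E3 E4) as (q2 & Eq2 & L3 & L4).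
    destruct (Hmax q1 q2 Eq1 Eq2) as (q & Eq & L5 & L6).
    destruct (HP q Eq) as (z' & Ez' & Lz' & Hx & Hy).
    destruct (Rle_dec (fst z') (x + w)); destruct (Rle_dec (snd z') (y + h));
      [apply N1 | apply N3 | apply N2 | apply N4]; exists z'; repeat split; try assumption; lra.
  - assert (Hnear : forall z delta, E z -> 0 < delta ->
              exists z', E z' /\ u z <= u z' /\ Cmod (z' - (a, b)) < delta).
    { intros z delta Hz Hd.
      destruct (Hab (delta / 2)) as (x & y & k & _ & Hk1 & Hk2 & HP & Ha & Hb); [lra |].
      destruct (HP z Hz) as (z' & Ez' & Lz' & Hx & Hy). exists z'.
      repeat split; try assumption.
      eapply Rle_lt_trans; [apply Cmod_2Rmax |].
      assert (Hm : Rmax (Rabs (fst (z' - (a, b))%C)) (Rabs (snd (z' - (a, b))%C)) < delta / 2).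
      { simpl. apply Rmax_lub_lt; apply Rabs_def1; lra. }
      assert (Hs : sqrt 2 < 2).
      { rewrite <- (sqrt_square 2) at 2 by lra. apply sqrt_lt_1; lra. }
      assert (0 <= sqrt 2) by apply sqrt_pos.
      assert (0 <= Rmax (Rabs (fst (z' - (a, b))%C)) (Rabs (snd (z' - (a, b))%C)))
        by (eapply Rle_trans; [apply Rabs_pos | apply Rmax_l]).
      nra. }
    assert (Eab : E (a, b)).
    { apply HE. intros HN. apply locally_Cmod in HN. destruct HN as (d & Hd & HN).
      destruct (Hnear z1 d Hz1 Hd) as (z' & Ez' & _ & Hz'). exact (HN z' Hz' Ez'). }
    exists (a, b). split; [exact Eab |]. intros z Hz. apply Rnot_lt_le. intros Hlt.
    destruct (proj1 (continuous_Cmod_R u (a, b)) (Hu _ Eab) (u z - u (a, b)))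
      as (d & Hd & Hc); [lra |].
    destruct (Hnear z d Hz Hd) as (z' & Ez' & Lz' & Hz').
    specialize (Hc z' Hz'). apply Rabs_def2 in Hc. lra.
Qed.

(** * Goursat's theorem *)

Lemma RInt_affine_approx (f : R -> R) (a b c0 c1 M : R) :
  a <= b -> ex_RInt f a b ->
  (forall t, a <= t <= b -> Rabs (f t - (c0 + c1 * t)) <= M) ->
  Rabs (RInt f a b - (c0 * (b - a) + c1 * (b ^ 2 - a ^ 2) / 2)) <= (b - a) * M.
Proof.
  intros Hab Hf HM.
  assert (HI : is_RInt (fun t => c0 + c1 * t) a b (c0 * (b - a) + c1 * (b ^ 2 - a ^ 2) / 2)).
  { replace (c0 * (b - a) + c1 * (b ^ 2 - a ^ 2) / 2) with
      (minus (c0 * b + c1 * b ^ 2 / 2) (c0 * a + c1 * a ^ 2 / 2))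
      by (unfold minus, plus, opp; simpl; field).
    apply (is_RInt_derive (fun t => c0 * t + c1 * t ^ 2 / 2)).
    - intros t _. auto_derive; [easy | simpl; field].
    - intros t _. apply (@ex_derive_continuous R_AbsRing R_NormedModule).
      auto_derive. easy. }
  rewrite <- (is_RInt_unique _ _ _ _ HI).
  change (Rabs (minus (RInt f a b) (RInt (fun t => c0 + c1 * t) a b)) <= (b - a) * M).
  rewrite <- RInt_minus; [| exact Hf | eexists; exact HI].
  apply abs_RInt_le_const; [exact Hab | | exact HM].
  apply ex_RInt_minus; [exact Hf | eexists; exact HI].
Qed.

Lemma continuity_2d_pt_sections (f : R -> R -> R) (x y : R) :
  continuity_2d_pt f x y ->
  continuous (fun s => f s y) x /\ continuous (fun t => f x t) y.
Proof.
  intros H. split; intros P [eps HP]; destruct (H eps) as [d Hd];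
    exists d; intros s Hs; apply HP; apply Hd; try exact Hs;
    rewrite Rminus_diag, Rabs_R0; apply cond_pos.
Qed.

(** [p + iq] is the complex derivative of [U + iV]; differentiability is meant in both variables
    jointly, which is stronger than the existence of partial derivatives. *)
Definition cauchy_riemann_pt (U V : R -> R -> R) (x y : R) : Prop :=
  exists p q : R, differentiable_pt_lim U x y p (- q) /\ differentiable_pt_lim V x y q p.

(** The imaginary part of the integral of [U + iV] along the boundary of
    [[x, x + w] * [y, y + h]]. *)
Definition Im_rect_int (U V : R -> R -> R) (x y w h : R) : R :=
  RInt (fun s => V s y) x (x + w) - RInt (fun s => V s (y + h)) x (x + w)
  + RInt (fun t => U (x + w) t) y (y + h) - RInt (fun t => U x t) y (y + h).

Lemma cauchy_riemann_ex_RInt (U V : R -> R -> R) (a a' b b' : R) :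
  (forall x y, a <= x <= a' -> b <= y <= b' -> cauchy_riemann_pt U V x y) ->
  (forall x x' y, a <= x <= x' -> x' <= a' -> b <= y <= b' -> ex_RInt (fun s => V s y) x x') /\
  (forall x y y', a <= x <= a' -> b <= y <= y' -> y' <= b' -> ex_RInt (fun t => U x t) y y').
Proof.
  intros HCR. split.
  - intros x x' y Hx Hx' Hy. apply (@ex_RInt_continuous R_CompleteNormedModule).
    intros s. rewrite Rmin_left, Rmax_right by lra. intros Hs.
    destruct (HCR s y) as (p & q & _ & HV); [lra | exact Hy |].
    apply (continuity_2d_pt_sections V s y), differentiable_continuity_pt. now exists q, p.
  - intros x y y' Hx Hy Hy'. apply (@ex_RInt_continuous R_CompleteNormedModule).
    intros t. rewrite Rmin_left, Rmax_right by lra. intros Ht.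
    destruct (HCR x t) as (p & q & HU & _); [exact Hx | lra |].
    apply (continuity_2d_pt_sections U x t), differentiable_continuity_pt. now exists p, (- q).
Qed.

(** By the Cauchy-Riemann equations the first-order expansion at [(a, b)] is a complex affine
    function, whose boundary integral vanishes. The remainder is at most [eps / 2 * (w + h)] on a
    boundary of length [2 * (w + h)]. *)
Lemma Im_rect_int_small (U V : R -> R -> R) (a b : R) (eps : R) :
  cauchy_riemann_pt U V a b -> 0 < eps ->
  exists delta : R, 0 < delta /\
    forall x y w h : R, 0 <= w < delta -> 0 <= h < delta ->
      x <= a <= x + w -> y <= b <= y + h ->
      (forall s t, x <= s <= x + w -> y <= t <= y + h -> cauchy_riemann_pt U V s t) ->
      Rabs (Im_rect_int U V x y w h) <= eps * (w + h) ^ 2.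
Proof.
  intros (p & q & HU & HV) Heps.
  assert (He : 0 < eps / 2) by lra.
  destruct (HU (mkposreal _ He)) as [d1 Hd1], (HV (mkposreal _ He)) as [d2 Hd2].
  simpl in Hd1, Hd2.
  exists (Rmin d1 d2). split; [apply Rmin_pos; apply cond_pos |].
  intros x y w h Hw Hh Ha Hb HCR.
  assert (Hm1 := Rmin_l d1 d2). assert (Hm2 := Rmin_r d1 d2).
  destruct (cauchy_riemann_ex_RInt _ _ _ _ _ _ HCR) as [HiV HiU].
  assert (Hclose : forall s t, x <= s <= x + w -> y <= t <= y + h ->
    Rabs (s - a) <= w /\ Rabs (t - b) <= h /\ Rmax (Rabs (s - a)) (Rabs (t - b)) <= w + h).
  { intros s t Hs Ht.
    assert (Rabs (s - a) <= w) by (apply Rabs_le; lra).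
    assert (Rabs (t - b) <= h) by (apply Rabs_le; lra).
    repeat split; try assumption. apply Rmax_lub; lra. }
  assert (EU : forall s t, x <= s <= x + w -> y <= t <= y + h ->
    Rabs (U s t - (U a b + p * (s - a) - q * (t - b))) <= eps / 2 * (w + h)).
  { intros s t Hs Ht. destruct (Hclose s t Hs Ht) as (C1 & C2 & C3).
    replace (U s t - (U a b + p * (s - a) - q * (t - b)))
      with (U s t - U a b - (p * (s - a) + - q * (t - b))) by ring.
    eapply Rle_trans; [apply Hd1; lra |]. apply Rmult_le_compat_l; lra. }
  assert (EV : forall s t, x <= s <= x + w -> y <= t <= y + h ->
    Rabs (V s t - (V a b + q * (s - a) + p * (t - b))) <= eps / 2 * (w + h)).
  { intros s t Hs Ht. destruct (Hclose s t Hs Ht) as (C1 & C2 & C3).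
    replace (V s t - (V a b + q * (s - a) + p * (t - b)))
      with (V s t - V a b - (q * (s - a) + p * (t - b))) by ring.
    eapply Rle_trans; [apply Hd2; lra |]. apply Rmult_le_compat_l; lra. }
  assert (IV : forall t, y <= t <= y + h ->
    Rabs (RInt (fun s => V s t) x (x + w)
          - ((V a b - q * a + p * (t - b)) * (x + w - x) + q * ((x + w) ^ 2 - x ^ 2) / 2))
    <= (x + w - x) * (eps / 2 * (w + h))).
  { intros t Ht. apply RInt_affine_approx; [lra | apply HiV; lra |].
    intros s Hs.
    replace (V a b - q * a + p * (t - b) + q * s) with (V a b + q * (s - a) + p * (t - b))
      by ring.
    now apply EV. }
  assert (IU : forall s, x <= s <= x + w ->
    Rabs (RInt (fun t => U s t) y (y + h)
          - ((U a b + q * b + p * (s - a)) * (y + h - y) + (- q) * ((y + h) ^ 2 - y ^ 2) / 2))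
    <= (y + h - y) * (eps / 2 * (w + h))).
  { intros s Hs. apply RInt_affine_approx; [lra | apply HiU; lra |].
    intros t Ht.
    replace (U a b + q * b + p * (s - a) + - q * t) with (U a b + p * (s - a) - q * (t - b))
      by ring.
    now apply EU. }
  assert (J1 := IV y ltac:(lra)). assert (J2 := IV (y + h) ltac:(lra)).
  assert (J3 := IU (x + w) ltac:(lra)). assert (J4 := IU x ltac:(lra)).
  unfold Im_rect_int. apply Rabs_le_between in J1, J2, J3, J4. apply Rabs_le.
  split; nra.
Qed.

Lemma goursat_rectangle (U V : R -> R -> R) (x0 y0 w0 h0 : R) :
  0 < w0 -> 0 < h0 ->
  (forall x y, x0 <= x <= x0 + w0 -> y0 <= y <= y0 + h0 -> cauchy_riemann_pt U V x y) ->
  Im_rect_int U V x0 y0 w0 h0 = 0.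
Proof.
  intros Hw0 Hh0 HCR.
  destruct (cauchy_riemann_ex_RInt _ _ _ _ _ _ HCR) as [HiV HiU].
  destruct (Req_dec (Im_rect_int U V x0 y0 w0 h0) 0) as [| HI]; [assumption | exfalso].
  assert (Hwh : 0 < w0 * h0) by now apply Rmult_lt_0_compat.
  (* The integral per unit area: since the integral is additive, some quarter always has a ratio at
     least as large. *)
  set (kappa := Rabs (Im_rect_int U V x0 y0 w0 h0) / (w0 * h0)).
  assert (Hkappa : 0 < kappa) by (apply Rdiv_lt_0_compat; [now apply Rabs_pos_lt | easy]).
  set (P := fun x y w h => 0 < w /\ 0 < h /\ x0 <= x /\ x + w <= x0 + w0 /\
     y0 <= y /\ y + h <= y0 + h0 /\ kappa * (w * h) <= Rabs (Im_rect_int U V x y w h)).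
  destruct (bisection_limit P x0 y0 w0 h0) as (a & b & Hab); [lra | lra | | |].
  - repeat split; try lra. unfold kappa. apply Req_le. field. lra.
  - intros x y w h (Hw & Hh & H1 & H2 & H3 & H4 & HP).
    assert (E : Im_rect_int U V x y (2 * w) (2 * h) =
       Im_rect_int U V x y w h + Im_rect_int U V (x + w) y w h
       + Im_rect_int U V x (y + h) w h + Im_rect_int U V (x + w) (y + h) w h).
    { unfold Im_rect_int.
      replace (x + 2 * w) with (x + w + w) by ring.
      replace (y + 2 * h) with (y + h + h) by ring.
      assert (CV : forall t, y <= t <= y + h + h -> RInt (fun s => V s t) x (x + w + w) =
        RInt (fun s => V s t) x (x + w) + RInt (fun s => V s t) (x + w) (x + w + w)).
      { intros t Ht. symmetry.
        apply (RInt_Chasles (V := R_CompleteNormedModule)); apply HiV; lra. }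
      assert (CU : forall s, x <= s <= x + w + w -> RInt (fun t => U s t) y (y + h + h) =
        RInt (fun t => U s t) y (y + h) + RInt (fun t => U s t) (y + h) (y + h + h)).
      { intros s Hs. symmetry.
        apply (RInt_Chasles (V := R_CompleteNormedModule)); apply HiU; lra. }
      rewrite (CV y), (CV (y + h + h)), (CU x), (CU (x + w + w)) by lra. ring. }
    rewrite E in HP.
    destruct (Rle_dec (kappa * (w * h)) (Rabs (Im_rect_int U V x y w h))).
    { left. repeat split; lra. }
    destruct (Rle_dec (kappa * (w * h)) (Rabs (Im_rect_int U V (x + w) y w h))).
    { right; left. repeat split; lra. }
    destruct (Rle_dec (kappa * (w * h)) (Rabs (Im_rect_int U V x (y + h) w h))).
    { right; right; left. repeat split; lra. }
    destruct (Rle_dec (kappa * (w * h)) (Rabs (Im_rect_int U V (x + w) (y + h) w h))).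
    { right; right; right. repeat split; lra. }
    exfalso. clear E.
    assert (T := Rabs_triang).
    assert (T1 := T (Im_rect_int U V x y w h + Im_rect_int U V (x + w) y w h
       + Im_rect_int U V x (y + h) w h) (Im_rect_int U V (x + w) (y + h) w h)).
    assert (T2 := T (Im_rect_int U V x y w h + Im_rect_int U V (x + w) y w h)
       (Im_rect_int U V x (y + h) w h)).
    assert (T3 := T (Im_rect_int U V x y w h) (Im_rect_int U V (x + w) y w h)).
    lra.
  (* This first use of [Hab], with an arbitrary tolerance, only places [(a, b)] in the initial
     rectangle. *)
  - destruct (Hab 1 ltac:(lra)) as (x1 & y1 & k1 & _ & _ & _ & HP1 & Ha & Hb).
    destruct HP1 as (_ & _ & H1 & H2 & H3 & H4 & _).
    (* Chosen so that the local estimate on a rectangle scaled by [k] is half of the lower bound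
       [kappa * (w0 * h0) * k ^ 2]. *)
    set (eps := kappa * (w0 * h0) / (2 * (w0 + h0) ^ 2)).
    assert (Heps : 0 < eps).
    { apply Rdiv_lt_0_compat; [now apply Rmult_lt_0_compat |].
      apply Rmult_lt_0_compat; [lra | apply pow_lt; lra]. }
    destruct (Im_rect_int_small U V a b eps (HCR a b ltac:(lra) ltac:(lra)) Heps)
      as (delta & Hd & Hsmall).
    clear x1 y1 k1 Ha Hb H1 H2 H3 H4.
    destruct (Hab delta Hd) as (x & y & k & Hk & Hkw & Hkh & HP & Ha & Hb).
    destruct HP as (Hw & Hh & H1 & H2 & H3 & H4 & HP).
    specialize (Hsmall x y (k * w0) (k * h0) ltac:(lra) ltac:(lra) Ha Hb).
    assert (HS := Rle_trans _ _ _ HP (Hsmall ltac:(intros s t Hs Ht; apply HCR; lra))).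
    replace (eps * (k * w0 + k * h0) ^ 2) with (kappa * (w0 * h0) * k ^ 2 / 2) in HS
      by (unfold eps; field; lra).
    assert (0 < kappa * (w0 * h0) * k ^ 2).
    { apply Rmult_lt_0_compat; [now apply Rmult_lt_0_compat | now apply pow_lt]. }
    nra.
Qed.

(** * Holomorphic functions in logarithmic polar coordinates *)

Lemma exp_monotone (x y : R) : x <= y -> exp x <= exp y.
Proof.
  intros [H | ->]; [apply Rlt_le; now apply exp_increasing | apply Rle_refl].
Qed.

Lemma is_derive_differentiable_Re_Im (K : C -> C) (a b : R) (l : C) :
  @is_derive C_AbsRing C_NormedModule K (a, b) l ->
  differentiable_pt_lim (fun s t => Re (K (s, t))) a b (Re l) (- Im l) /\
  differentiable_pt_lim (fun s t => Im (K (s, t))) a b (Im l) (Re l).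
Proof.
  intros HK.
  assert (H : forall eps : posreal, locally_2d (fun s t =>
    Cmod (K (s, t) - K (a, b) - ((s, t) - (a, b)) * l)%C
      <= eps * Rmax (Rabs (s - a)) (Rabs (t - b))) a b).
  { intros eps.
    destruct (proj1 (is_derive_Cmod K (a, b) l) HK (eps / 2)) as (d & Hd & H).
    { apply Rdiv_lt_0_compat; [apply cond_pos | lra]. }
    assert (Hd2 : 0 < d / 2) by lra.
    exists (mkposreal _ Hd2). simpl. intros s t Hs Ht.
    assert (Hm := Cmod_2Rmax ((s, t) - (a, b))%C). simpl in Hm.
    change (s + - a) with (s - a) in Hm. change (t + - b) with (t - b) in Hm.
    assert (Hr : sqrt 2 <= 2).
    { rewrite <- (sqrt_square 2) at 2 by lra. apply sqrt_le_1; lra. }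
    assert (H0 : 0 <= Rmax (Rabs (s - a)) (Rabs (t - b)))
      by (eapply Rle_trans; [apply Rabs_pos | apply Rmax_l]).
    assert (H1 : Rmax (Rabs (s - a)) (Rabs (t - b)) < d / 2) by (apply Rmax_lub_lt; lra).
    assert (H2 : Cmod ((s, t) - (a, b))%C <= 2 * Rmax (Rabs (s - a)) (Rabs (t - b))) by nra.
    eapply Rle_trans; [apply H; lra |].
    assert (He := cond_pos eps). nra. }
  split; intros eps; destruct (H eps) as [d Hd]; exists d; intros s t Hs Ht;
    (eapply Rle_trans; [| exact (Hd s t Hs Ht)]);
    eapply Rle_trans; [| apply Rmax_Cmod | | apply Rmax_Cmod].
  - eapply Rle_trans; [| apply Rmax_l]. apply Req_le. f_equal. unfold Re, Im. simpl. ring.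
  - eapply Rle_trans; [| apply Rmax_r]. apply Req_le. f_equal. unfold Re, Im. simpl. ring.
Qed.

Lemma differentiable_pt_lim_Rmult (x y : R) :
  differentiable_pt_lim (fun u v => u * v) x y y x.
Proof.
  intros eps. exists eps. intros u v Hu Hv.
  replace (u * v - x * y - (y * (u - x) + x * (v - y))) with ((u - x) * (v - y)) by ring.
  rewrite Rabs_mult.
  assert (H1 := Rabs_pos (u - x)). assert (H2 := Rmax_r (Rabs (u - x)) (Rabs (v - y))).
  assert (H3 := Rabs_pos (v - y)). nra.
Qed.

Lemma differentiable_pt_lim_separable (f g : R -> R) (x y f' g' : R) :
  derivable_pt_lim f x f' -> derivable_pt_lim g y g' ->
  differentiable_pt_lim (fun s t => f s * g t) x y (f' * g y) (f x * g').
Proof.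
  intros Hf Hg.
  replace (f' * g y) with (g y * f' + f x * 0) by ring.
  replace (f x * g') with (g y * 0 + f x * g') by ring.
  apply (differentiable_pt_lim_comp Rmult (fun s _ => f s) (fun _ t => g t)).
  - apply differentiable_pt_lim_Rmult.
  - now apply differentiable_pt_lim_proj1_0.
  - intros eps. destruct (differentiable_pt_lim_proj1_0 g y x g' Hg eps) as [d Hd].
    exists d. intros s t Hs Ht. specialize (Hd t s Ht Hs). simpl in Hd.
    rewrite Rmax_comm. now rewrite Rplus_comm.
Qed.

Lemma cauchy_riemann_pt_log_polar (K : C -> C) (z0 : C) (x y : R) :
  @ex_derive C_AbsRing C_NormedModule K (z0 + Cexp (x, y))%C ->
  cauchy_riemann_pt (fun s t => Re (K (z0 + Cexp (s, t))%C))
    (fun s t => Im (K (z0 + Cexp (s, t))%C)) x y.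
Proof.
  intros [l Hl].
  apply is_derive_differentiable_Re_Im in Hl. destruct Hl as [HU HV].
  assert (shift : forall (c x y lx ly : R) (f : R -> R -> R),
    differentiable_pt_lim f x y lx ly ->
    differentiable_pt_lim (fun s t => c + f s t) x y lx ly).
  { intros c x' y' lx ly f H eps. destruct (H eps) as [d Hd]. exists d. intros s t Hs Ht.
    replace (c + f s t - (c + f x' y')) with (f s t - f x' y') by ring. now apply Hd. }
  assert (H1 : differentiable_pt_lim (fun s t => fst (z0 + Cexp (s, t))%C) x y
                 (exp x * cos y) (exp x * - sin y)).
  { apply shift, (differentiable_pt_lim_separable exp cos);
      [apply derivable_pt_lim_exp | apply derivable_pt_lim_cos]. }
  assert (H2 : differentiable_pt_lim (fun s t => snd (z0 + Cexp (s, t))%C) x y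
                 (exp x * sin y) (exp x * cos y)).
  { apply shift, (differentiable_pt_lim_separable exp sin);
      [apply derivable_pt_lim_exp | apply derivable_pt_lim_sin]. }
  assert (EU := differentiable_pt_lim_comp _ _ _ _ _ _ _ _ _ _ _ HU H1 H2).
  assert (EV := differentiable_pt_lim_comp _ _ _ _ _ _ _ _ _ _ _ HV H1 H2).
  (* Real and imaginary parts of [l * Cexp (x, y)], the derivative given by the complex chain
     rule. *)
  exists (Re l * (exp x * cos y) - Im l * (exp x * sin y)).
  exists (Im l * (exp x * cos y) + Re l * (exp x * sin y)).
  split; [ refine (eq_ind _ (fun c => differentiable_pt_lim _ x y c _) _ _ _);
           [refine (eq_ind _ (differentiable_pt_lim _ x y _) EU _ _) |]
         | refine (eq_ind _ (fun c => differentiable_pt_lim _ x y c _) _ _ _);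
           [refine (eq_ind _ (differentiable_pt_lim _ x y _) EV _ _) |] ]; ring.
Qed.

Lemma Cmod_Cexp (x y : R) : Cmod (Cexp (x, y)) = exp x.
Proof.
  unfold Cmod, Cexp, Re, Im. cbn [fst snd].
  replace ((exp x * cos y) ^ 2 + (exp x * sin y) ^ 2)
    with (exp x ^ 2 * (Rsqr (sin y) + Rsqr (cos y))) by (unfold Rsqr; ring).
  rewrite sin2_cos2, Rmult_1_r. apply sqrt_pow2. apply Rlt_le, exp_pos.
Qed.

Lemma Cexp_surjective (z : C) : z <> 0 -> exists x y : R, z = Cexp (x, y).
Proof.
  intros Hz. assert (Hm : 0 < Cmod z) by now apply Cmod_gt_0.
  set (c := fst z / Cmod z). set (s := snd z / Cmod z).
  assert (Hcs : c ^ 2 + s ^ 2 = 1).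
  { assert (E := Cmod2_alt z). unfold Re, Im in E. unfold c, s.
    replace ((fst z / Cmod z) ^ 2 + (snd z / Cmod z) ^ 2)
      with ((fst z ^ 2 + snd z ^ 2) / Cmod z ^ 2) by (field; lra).
    rewrite <- E. field. lra. }
  assert (Hc : -1 <= c <= 1) by nra.
  assert (Hy : exists y, cos y = c /\ sin y = s).
  { assert (Hs : sqrt (1 - Rsqr c) = Rabs s).
    { rewrite <- sqrt_Rsqr_abs. f_equal. unfold Rsqr. lra. }
    destruct (Rle_dec 0 s).
    - exists (acos c). rewrite cos_acos, sin_acos, Hs by exact Hc.
      split; [reflexivity |]. now apply Rabs_pos_eq.
    - exists (- acos c). rewrite cos_neg, sin_neg, cos_acos, sin_acos, Hs by exact Hc.
      split; [reflexivity |]. rewrite Rabs_left by lra. ring. }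
  destruct Hy as (y & Hcos & Hsin).
  exists (ln (Cmod z)), y. unfold Cexp, Re, Im. cbn [fst snd].
  rewrite exp_ln, Hcos, Hsin by exact Hm. unfold c, s.
  rewrite (surjective_pairing z) at 1. f_equal; field; lra.
Qed.

Lemma Cexp_periodic (x y : R) : Cexp (x, y + 2 * PI) = Cexp (x, y).
Proof.
  unfold Cexp, Re, Im. cbn [fst snd].
  now rewrite cos_plus, sin_plus, cos_2PI, sin_2PI, !Rmult_0_r, !Rmult_1_r, Rminus_0_r, Rplus_0_r.
Qed.

(** The integral from [a] to any [s] is squeezed to 0, so the derivative [f t] of this primitive
    vanishes wherever it is two-sided. *)
Lemma RInt_ge_0_eq_0 (f : R -> R) (a b : R) :
  (forall t, a <= t <= b -> continuous f t) -> (forall t, a <= t <= b -> 0 <= f t) ->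
  RInt f a b = 0 -> forall t, a < t < b -> f t = 0.
Proof.
  intros Hc Hf HI t Ht.
  assert (Hex : forall s s', a <= s <= s' -> s' <= b -> ex_RInt f s s').
  { intros s s' Hs Hs'. apply (@ex_RInt_continuous R_CompleteNormedModule).
    intros r. rewrite Rmin_left, Rmax_right by lra. intros Hr. apply Hc. lra. }
  assert (Hz : forall s, a <= s <= b -> RInt f a s = 0).
  { intros s Hs.
    assert (H1 : 0 <= RInt f a s) by (apply RInt_ge_0; [lra | apply Hex; lra | intros; apply Hf; lra]).
    assert (H2 : 0 <= RInt f s b) by (apply RInt_ge_0; [lra | apply Hex; lra | intros; apply Hf; lra]).
    assert (H3 : RInt f a s + RInt f s b = RInt f a b)
      by (apply (RInt_Chasles (V := R_CompleteNormedModule)); apply Hex; lra).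
    lra. }
  assert (Hr : 0 < Rmin (t - a) (b - t)) by (apply Rmin_pos; lra).
  assert (Hm1 := Rmin_l (t - a) (b - t)). assert (Hm2 := Rmin_r (t - a) (b - t)).
  assert (H0 : is_derive (fun _ : R => 0) t (f t)).
  { apply (is_derive_RInt f (fun _ => 0) a).
    - exists (mkposreal _ Hr). intros s Hs.
      assert (Hs' : Rabs (s - t) < Rmin (t - a) (b - t)) by exact Hs.
      apply Rabs_def2 in Hs'. rewrite <- (Hz s) by lra.
      apply (@RInt_correct R_CompleteNormedModule). apply Hex; lra.
    - apply Hc. lra. }
  apply is_derive_unique in H0. rewrite Derive_const in H0. now symmetry.
Qed.

(* In the coordinate [log (z - z0)] the two horizontal sides of the rectangle
   [[x', x] * [y, y + 2 PI]] cancel by periodicity, so Goursat's theorem says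
   that the circle means of [Re K] do not depend on the radius. *)
Lemma log_polar_circle_integral (K : C -> C) (z0 : C) (x' x y : R) :
  x' < x ->
  (forall z, 0 < Cmod (z - z0) <= exp x -> @ex_derive C_AbsRing C_NormedModule K z) ->
  RInt (fun t => Re (K (z0 + Cexp (x, t))%C)) y (y + 2 * PI) =
  RInt (fun t => Re (K (z0 + Cexp (x', t))%C)) y (y + 2 * PI).
Proof.
  intros Hx HK. assert (HPI := PI_RGT_0).
  assert (G : Im_rect_int (fun s t => Re (K (z0 + Cexp (s, t))%C))
                (fun s t => Im (K (z0 + Cexp (s, t))%C)) x' y (x - x') (2 * PI) = 0).
  { apply goursat_rectangle; [lra | lra |].
    intros s t Hs _. apply cauchy_riemann_pt_log_polar, HK.
    replace (z0 + Cexp (s, t) - z0)%C with (Cexp (s, t)) by ring.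
    rewrite Cmod_Cexp. split; [apply exp_pos | apply exp_monotone; lra]. }
  unfold Im_rect_int in G.
  replace (x' + (x - x')) with x in G by ring.
  rewrite (RInt_ext (fun s => Im (K (z0 + Cexp (s, (y + 2 * PI)%R))%C))
                    (fun s => Im (K (z0 + Cexp (s, y))%C))) in G
    by (intros s _; now rewrite Cexp_periodic).
  lra.
Qed.

(** The mean of [Re K] is the same on all circles about [z0]; small circles and continuity identify
    it with [Re (K z0)]. The defect [Re (K z0) - Re K] is then nonnegative with mean 0, hence zero
    on each circle. *)
Lemma Re_max_at_center_const (K : C -> C) (z0 : C) (rho : R) :
  (forall z, 0 < Cmod (z - z0) < rho -> @ex_derive C_AbsRing C_NormedModule K z) ->
  @continuous C_UniformSpace C_UniformSpace K z0 ->
  (forall z, Cmod (z - z0) < rho -> Re (K z) <= Re (K z0)) ->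
  forall z, Cmod (z - z0) < rho -> Re (K z) = Re (K z0).
Proof.
  intros HK Hc Hmax z Hz. assert (HPI := PI_RGT_0).
  destruct (Ceq_dec (z - z0) 0) as [E | Hne].
  { now replace z with z0 by (rewrite <- (Cplus_0_l z0), <- E; ring). }
  destruct (Cexp_surjective _ Hne) as (x & y & Exy).
  rewrite Exy, Cmod_Cexp in Hz.
  set (g := fun s t => Re (K (z0 + Cexp (s, t))%C)).
  assert (Hmod : forall s t, Cmod (z0 + Cexp (s, t) - z0)%C = exp s).
  { intros s t. replace (z0 + Cexp (s, t) - z0)%C with (Cexp (s, t)) by ring.
    apply Cmod_Cexp. }
  assert (Hcont : forall s t, s <= x -> continuous (g s) t).
  { intros s t Hs.
    destruct (cauchy_riemann_pt_log_polar K z0 s t) as (p & q & HU & _).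
    - apply HK. rewrite Hmod. split; [apply exp_pos |].
      eapply Rle_lt_trans; [| exact Hz]. now apply exp_monotone.
    - apply (continuity_2d_pt_sections g), differentiable_continuity_pt. now exists p, (- q). }
  (* The period starts at [y - PI] so that the angle [y] of [z] is interior to it, as
     [RInt_ge_0_eq_0] requires. *)
  assert (Hex : forall s, s <= x -> ex_RInt (g s) (y - PI) (y - PI + 2 * PI)).
  { intros s Hs. apply (@ex_RInt_continuous R_CompleteNormedModule).
    intros t _. now apply Hcont. }
  assert (Hconst : ex_RInt (fun _ : R => Re (K z0)) (y - PI) (y - PI + 2 * PI))
    by apply @ex_RInt_const.
  assert (Hdiff : forall s, s <= x ->
    RInt (fun t => Re (K z0) - g s t) (y - PI) (y - PI + 2 * PI) =
    2 * PI * Re (K z0) - RInt (g s) (y - PI) (y - PI + 2 * PI)).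
  { intros s Hs. etransitivity.
    - apply (RInt_minus (V := R_CompleteNormedModule)); [exact Hconst | now apply Hex].
    - rewrite RInt_const. unfold minus, plus, opp, scal. simpl. unfold mult. simpl. ring. }
  assert (Hmean : RInt (g x) (y - PI) (y - PI + 2 * PI) = 2 * PI * Re (K z0)).
  { apply cond_eq. intros eps Heps.
    destruct (proj1 (continuous_Cmod_C K z0) Hc (eps / (4 * PI))) as (d & Hd & HKd).
    { apply Rdiv_lt_0_compat; lra. }
    set (x' := Rmin (x - 1) (ln (d / 2))).
    assert (Hx' : x' < x) by (assert (H := Rmin_l (x - 1) (ln (d / 2))); unfold x'; lra).
    assert (Hexp : exp x' < d).
    { apply Rle_lt_trans with (exp (ln (d / 2))).
      - apply exp_monotone, Rmin_r.
      - rewrite exp_ln; lra. }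
    unfold g at 1. rewrite (log_polar_circle_integral K z0 x') by
      (try exact Hx'; intros w Hw; apply HK; lra).
    rewrite Rabs_minus_sym. fold (g x'). rewrite <- Hdiff by lra.
    apply Rle_lt_trans with ((y - PI + 2 * PI - (y - PI)) * (eps / (4 * PI))).
    - apply abs_RInt_le_const; [lra | |].
      + apply (ex_RInt_minus (V := R_NormedModule)); [exact Hconst | apply Hex; lra].
      + intros t _. rewrite Rabs_minus_sym. apply Rlt_le.
        eapply Rle_lt_trans; [| apply (HKd (z0 + Cexp (x', t))%C); now rewrite Hmod].
        eapply Rle_trans; [| apply re_le_Cmod]. apply Req_le. f_equal.
    - replace ((y - PI + 2 * PI - (y - PI)) * (eps / (4 * PI))) with (eps / 2) by (field; lra).
      lra. }
  assert (H0 : Re (K z0) - g x y = 0).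
  { apply (RInt_ge_0_eq_0 (fun t => Re (K z0) - g x t) (y - PI) (y - PI + 2 * PI)).
    - intros t _. apply (continuous_minus (V := R_NormedModule)); [apply continuous_const |].
      apply Hcont. lra.
    - intros t _. enough (g x t <= Re (K z0)) by lra. apply Hmax. now rewrite Hmod.
    - rewrite Hdiff by lra. rewrite Hmean. apply Rminus_diag.
    - lra. }
  replace z with (z0 + Cexp (x, y))%C by (rewrite <- Exy; ring).
  unfold g in H0. lra.
Qed.

(** * Maximum principle with a subharmonic barrier *)

Lemma Cmod_triangle_rev (z w : C) : Cmod w - Cmod z <= Cmod (w - z).
Proof.
  assert (H := Cmod_triangle z (w - z)). replace (z + (w - z))%C with w in H by ring. lra.
Qed.

Lemma continuous_Re (g : C -> C) (z : C) :
  @continuous C_UniformSpace C_UniformSpace g z ->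
  @continuous C_UniformSpace R_UniformSpace (fun w => Re (g w)) z.
Proof.
  intros H. apply continuous_Cmod_R. intros eps Heps.
  destruct (proj1 (continuous_Cmod_C g z) H eps Heps) as (d & Hd & Hg).
  exists d. split; [exact Hd |]. intros w Hw.
  eapply Rle_lt_trans; [apply (re_le_Cmod (g w - g z)%C) | now apply Hg].
Qed.

Lemma continuous_Cmod_comp (g : C -> C) (z : C) :
  @continuous C_UniformSpace C_UniformSpace g z ->
  @continuous C_UniformSpace R_UniformSpace (fun w => Cmod (g w)) z.
Proof.
  intros H. apply continuous_Cmod_R. intros eps Heps.
  destruct (proj1 (continuous_Cmod_C g z) H eps Heps) as (d & Hd & Hg).
  exists d. split; [exact Hd |]. intros w Hw.
  eapply Rle_lt_trans; [| now apply (Hg w)].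
  assert (H1 := Cmod_triangle_rev (g z) (g w)). assert (H2 := Cmod_triangle_rev (g w) (g z)).
  replace (g z - g w)%C with (- (g w - g z))%C in H2 by ring. rewrite Cmod_opp in H2.
  apply Rabs_le. lra.
Qed.

Lemma continuous_Cscal (c : C) (g : C -> C) (z : C) :
  @continuous C_UniformSpace C_UniformSpace g z ->
  @continuous C_UniformSpace C_UniformSpace (fun w => (c * g w)%C) z.
Proof.
  intros H. apply continuous_Cmod_C. intros eps Heps.
  assert (Hc : 0 < Cmod c + 1) by (assert (H0 := Cmod_ge_0 c); lra).
  destruct (proj1 (continuous_Cmod_C g z) H (eps / (Cmod c + 1))) as (d & Hd & Hg).
  { now apply Rdiv_lt_0_compat. }
  exists d. split; [exact Hd |]. intros w Hw. specialize (Hg w Hw).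
  replace (c * g w - c * g z)%C with (c * (g w - g z))%C by ring. rewrite Cmod_mult.
  apply (Rmult_lt_compat_r (Cmod c + 1)) in Hg; [| exact Hc].
  replace (eps / (Cmod c + 1) * (Cmod c + 1)) with eps in Hg by (field; lra).
  assert (H0 := Cmod_ge_0 (g w - g z)%C). lra.
Qed.

(* [C_NormedModule] and [AbsRing_NormedModule C_AbsRing] are not convertible,
   although they have the same norm and the same neighbourhoods. *)
Lemma is_derive_C_AbsRing (f : C -> C) (z l : C) :
  @is_derive C_AbsRing C_NormedModule f z l <->
  @is_derive C_AbsRing (AbsRing_NormedModule C_AbsRing) f z l.
Proof.
  split; intros [[H1 H2 H3] H]; split; try exact H; constructor; assumption.
Qed.

Lemma ex_derive_Cmult (f g : C -> C) (z : C) :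
  @ex_derive C_AbsRing C_NormedModule f z -> @ex_derive C_AbsRing C_NormedModule g z ->
  @ex_derive C_AbsRing C_NormedModule (fun w => (f w * g w)%C) z.
Proof.
  intros [l Hl] [m Hm]. apply is_derive_C_AbsRing in Hl, Hm.
  eexists. apply is_derive_C_AbsRing.
  apply (is_derive_mult (K := C_AbsRing) f g z l m Hl Hm). apply Cmult_comm.
Qed.

Lemma ex_derive_Cscal (c : C) (g : C -> C) (z : C) :
  @ex_derive C_AbsRing C_NormedModule g z ->
  @ex_derive C_AbsRing C_NormedModule (fun w => (c * g w)%C) z.
Proof.
  intros Hg. apply (ex_derive_Cmult (fun _ => c)); [| exact Hg].
  apply (@ex_derive_const C_AbsRing C_NormedModule).
Qed.

Lemma ex_derive_Cinv (z : C) :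
  z <> 0 -> @ex_derive C_AbsRing C_NormedModule Cinv z.
Proof.
  intros Hz. assert (Hm : 0 < Cmod z) by now apply Cmod_gt_0.
  exists (- / (z * z))%C. apply is_derive_Cmod. intros eps Heps.
  assert (H3 : 0 < Cmod z ^ 3) by now apply pow_lt.
  (* The remainder is [(w - z)^2 / (w z^2)]. The first bound gives [|w| > |z| / 2], hence a
     remainder of at most [2 |w - z|^2 / |z|^3]; the second brings this below [eps |w - z|]. *)
  exists (Rmin (Cmod z / 2) (eps * Cmod z ^ 3 / 2)).
  split. { apply Rmin_pos; [lra |]. assert (0 < eps * Cmod z ^ 3) by nra. lra. }
  intros w Hw.
  assert (M1 := Rmin_l (Cmod z / 2) (eps * Cmod z ^ 3 / 2)).
  assert (M2 := Rmin_r (Cmod z / 2) (eps * Cmod z ^ 3 / 2)).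
  assert (Hw2 : Cmod z / 2 < Cmod w).
  { assert (H := Cmod_triangle_rev w z).
    replace (z - w)%C with (- (w - z))%C in H by ring. rewrite Cmod_opp in H. lra. }
  assert (Hw0 : w <> 0) by (apply Cmod_gt_0; lra).
  replace (/ w - / z - (w - z) * - / (z * z))%C
    with ((w - z) * (w - z) / (w * (z * z)))%C by (field; now split).
  rewrite Cmod_div, !Cmod_mult by (apply Cmult_neq_0; [| apply Cmult_neq_0]; assumption).
  assert (H0 := Cmod_ge_0 (w - z)%C).
  assert (Hp : 0 < Cmod w * (Cmod z * Cmod z)) by (apply Rmult_lt_0_compat; nra).
  apply Rle_div_l; [exact Hp |].
  rewrite (Rmult_comm eps), Rmult_assoc.
  apply Rmult_le_compat_l; [exact H0 |].
  assert (H1 : Cmod z / 2 * (Cmod z * Cmod z) <= Cmod w * (Cmod z * Cmod z))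
    by (apply Rmult_le_compat_r; nra).
  nra.
Qed.

Lemma ex_derive_C_continuous (g : C -> C) (z : C) :
  @ex_derive C_AbsRing C_NormedModule g z ->
  @continuous C_UniformSpace C_UniformSpace g z.
Proof.
  intros H P HP. apply locally_C. now apply (@ex_derive_continuous C_AbsRing C_NormedModule g z H).
Qed.

Lemma closed_annulus (rho r : R) :
  @closed C_UniformSpace (fun z => rho <= Cmod z <= r).
Proof.
  intros z Hz. split; apply Rnot_lt_le; intros Hlt; apply Hz, locally_Cmod.
  - exists (rho - Cmod z). split; [lra |]. intros w Hw [H _].
    assert (T := Cmod_triangle_rev z w). lra.
  - exists (Cmod z - r). split; [lra |]. intros w Hw [_ H].
    assert (T := Cmod_triangle_rev w z).
    replace (z - w)%C with (- (w - z))%C in T by ring. rewrite Cmod_opp in T. lra.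
Qed.

(* At an interior maximum [z0] of [Re g + eps |phi|^2], the identity
   [|phi|^2 = |phi z0|^2 + 2 Re (conj (phi z0) (phi - phi z0)) + |phi - phi z0|^2]
   turns [z0] into a strict maximum of the real part of the holomorphic function
   [g + 2 eps conj (phi z0) phi]. A negative [rho] gives the full disc. *)
Lemma barrier_maximum (g phi : C -> C) (rho r eps : R) (z1 : C) :
  0 < eps -> rho <= Cmod z1 <= r ->
  (forall z : C, rho <= Cmod z <= r -> @continuous C_UniformSpace C_UniformSpace g z /\
     @continuous C_UniformSpace C_UniformSpace phi z) ->
  (forall z : C, z <> 0 -> rho < Cmod z < r -> @ex_derive C_AbsRing C_NormedModule g z /\
     @ex_derive C_AbsRing C_NormedModule phi z) ->
  (forall z w : C, rho <= Cmod z <= r -> rho <= Cmod w <= r -> phi z = phi w -> z = w) ->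
  exists z : C, (Cmod z = rho \/ Cmod z = r) /\
    Re (g z1) + eps * Cmod (phi z1) ^ 2 <= Re (g z) + eps * Cmod (phi z) ^ 2.
Proof.
  intros Heps Hz1 Hc Hd Hinj.
  destruct (extreme_value_C (fun z => rho <= Cmod z <= r) r
    (fun z => Re (g z) + eps * Cmod (phi z) ^ 2) z1) as (z0 & Hz0 & Hmax).
  - apply closed_annulus.
  - intros z Hz. lra.
  - intros z Hz. destruct (Hc z Hz) as [Hcg Hcp].
    apply (continuous_plus (V := R_NormedModule)); [now apply continuous_Re |].
    apply (continuous_scal_r (V := R_NormedModule) eps).
    apply (continuous_ext (fun w => mult (Cmod (phi w)) (Cmod (phi w)))).
    + intros w. unfold mult. simpl. ring.
    + apply (continuous_mult (K := R_AbsRing)); now apply continuous_Cmod_comp.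
  - exact Hz1.
  - exists z0. split; [| now apply Hmax].
    destruct (Req_dec (Cmod z0) rho) as [| N1]; [now left |].
    destruct (Req_dec (Cmod z0) r) as [| N2]; [now right | exfalso].
    (* The last term keeps the origin out of the disc about [z0], unless [z0] is the origin; in that
       case continuity at the centre suffices. *)
    set (delta := Rmin (Rmin (Cmod z0 - rho) (r - Cmod z0))
                       (if Ceq_dec z0 0 then 1 else Cmod z0)).
    assert (M1 : delta <= Cmod z0 - rho) by (eapply Rle_trans; [apply Rmin_l | apply Rmin_l]).
    assert (M2 : delta <= r - Cmod z0) by (eapply Rle_trans; [apply Rmin_l | apply Rmin_r]).
    assert (M3 : delta <= if Ceq_dec z0 0 then 1 else Cmod z0) by apply Rmin_r.
    assert (Hdelta : 0 < delta).
    { apply Rmin_pos; [apply Rmin_pos; lra |].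
      destruct (Ceq_dec z0 0); [lra | now apply Cmod_gt_0]. }
    assert (Hin : forall z, Cmod (z - z0) < delta -> rho < Cmod z < r).
    { intros z Hz. assert (T1 := Cmod_triangle_rev z z0). assert (T2 := Cmod_triangle_rev z0 z).
      replace (z0 - z)%C with (- (z - z0))%C in T1 by ring. rewrite Cmod_opp in T1. lra. }
    set (K := fun z => (g z + RtoC (2 * eps) * Cconj (phi z0) * phi z)%C).
    assert (HKu : forall z, Re (K z) - Re (K z0) =
      Re (g z) + eps * Cmod (phi z) ^ 2 - (Re (g z0) + eps * Cmod (phi z0) ^ 2)
      - eps * Cmod (phi z - phi z0)%C ^ 2).
    { intros z. rewrite !Cmod2_alt. unfold K, Re, Im. simpl. ring. }
    assert (HKconst : forall z, Cmod (z - z0) < delta -> Re (K z) = Re (K z0)).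
    { apply Re_max_at_center_const.
      - intros z Hz. assert (Hz' : z <> 0).
        { intros ->. replace (0 - z0)%C with (- z0)%C in Hz by ring. rewrite Cmod_opp in Hz.
          destruct (Ceq_dec z0 0) as [-> |]; [rewrite Cmod_0 in Hz |]; lra. }
        destruct (Hd z Hz') as [Hg Hp]; [apply Hin; lra |].
        apply (ex_derive_plus (K := C_AbsRing) (V := C_NormedModule)); [exact Hg |].
        now apply ex_derive_Cscal.
      - destruct (Hc z0 Hz0) as [Hg Hp].
        apply (continuous_plus (U := C_UniformSpace) (V := C_R_NormedModule)); [exact Hg |].
        now apply continuous_Cscal.
      - intros z Hz. specialize (HKu z). specialize (Hin z Hz).
        assert (H := Hmax z ltac:(lra)). simpl in H.
        assert (0 <= eps * Cmod (phi z - phi z0)%C ^ 2) by (apply Rmult_le_pos; [lra | apply pow2_ge_0]).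
        lra. }
    (* Any second point of the disc would do: with [Re K] constant, [HKu] makes the barrier sum at
       [z] exceed its maximum by [eps * |phi z - phi z0|^2], which is positive by injectivity. *)
    set (z := (z0 + RtoC (delta / 2))%C).
    assert (Ez : Cmod (z - z0) = delta / 2).
    { unfold z. replace (z0 + RtoC (delta / 2) - z0)%C with (RtoC (delta / 2)) by ring.
      rewrite Cmod_R. apply Rabs_pos_eq. lra. }
    specialize (HKu z). rewrite (HKconst z ltac:(lra)) in HKu.
    assert (Hz := Hin z ltac:(lra)). assert (H := Hmax z ltac:(lra)). simpl in H.
    assert (Hne : (phi z - phi z0)%C <> 0).
    { intros E. assert (E' : z = z0).
      { apply Hinj; [lra | lra |].
        replace (phi z) with (phi z - phi z0 + phi z0)%C by ring. rewrite E. ring. }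
      rewrite E' in Ez. replace (z0 - z0)%C with (RtoC 0) in Ez by ring.
      rewrite Cmod_0 in Ez. lra. }
    apply Cmod_gt_0 in Hne.
    assert (0 < eps * Cmod (phi z - phi z0)%C ^ 2) by (apply Rmult_lt_0_compat; [lra | now apply pow_lt]).
    lra.
Qed.

(** * Schwarz's lemma and the boundary derivative *)

Lemma Cmod_rotate (z : C) : exists c : C, Cmod c = 1 /\ (c * z)%C = RtoC (Cmod z).
Proof.
  destruct (Ceq_dec z 0) as [-> | Hz].
  - exists (RtoC 1). rewrite Cmod_1, Cmod_0. split; [reflexivity | ring].
  - assert (Hm : 0 < Cmod z) by now apply Cmod_gt_0.
    assert (Hm' : RtoC (Cmod z) <> 0) by (intros E; apply RtoC_inj in E; lra).
    exists (Cconj z / Cmod z)%C. split.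
    + rewrite Cmod_div, Cmod_conj, Cmod_R, Rabs_pos_eq by (assumption || lra). field. lra.
    + replace (Cconj z / Cmod z * z)%C with (z * Cconj z / Cmod z)%C by (field; exact Hm').
      rewrite <- Cmod2_conj, RtoC_pow. field. exact Hm'.
Qed.

Lemma Re_eq_1_Cmod_le_1 (z : C) : Cmod z <= 1 -> Re z = 1 -> z = RtoC 1.
Proof.
  intros Hm HR. assert (E := Cmod2_alt z). rewrite HR in E.
  assert (Cmod z ^ 2 <= 1) by (assert (H := Cmod_ge_0 z); nra).
  assert (HI : Im z = 0) by nra.
  rewrite (surjective_pairing z). unfold Re, Im in HR, HI. now rewrite HR, HI.
Qed.

Definition holomorphic_punctured (g : C -> C) : Prop :=
  @continuous C_UniformSpace C_UniformSpace g (RtoC 0) /\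
  forall z : C, z <> 0 -> unit_disc z -> @ex_derive C_AbsRing C_NormedModule g z.

Lemma holomorphic_punctured_continuous (g : C -> C) (z : C) :
  holomorphic_punctured g -> unit_disc z -> @continuous C_UniformSpace C_UniformSpace g z.
Proof.
  intros [Hc Hd] Hz. destruct (Ceq_dec z 0) as [-> | Hz0]; [exact Hc |].
  apply ex_derive_C_continuous. now apply Hd.
Qed.

Lemma holomorphic_punctured_Cscal (c : C) (g : C -> C) :
  holomorphic_punctured g -> holomorphic_punctured (fun z => (c * g z)%C).
Proof.
  intros [Hc Hd]. split; [now apply continuous_Cscal |].
  intros z Hz0 Hz. apply ex_derive_Cscal. now apply Hd.
Qed.

(** On [|z| = r] the hypothesis reads [|g| <= 1 / r]. The barrier [(1 - r) |z|^2] adds at most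
    [1 - r], and both errors disappear as [r] tends to 1. *)
Lemma schwarz_bound (g : C -> C) :
  holomorphic_punctured g ->
  (forall z, unit_disc z -> Cmod z * Cmod (g z) <= 1) ->
  forall z, unit_disc z -> Cmod (g z) <= 1.
Proof.
  intros Hg Hb z1 Hz1. unfold unit_disc in *.
  destruct (Cmod_rotate (g z1)) as (c & Hc & Ec).
  assert (Hcg := holomorphic_punctured_Cscal c g Hg).
  assert (Hr : forall r, Cmod z1 < r < 1 -> Cmod (g z1) <= / r + (1 - r)).
  { intros r Hr. assert (H1 := Cmod_ge_0 z1).
    destruct (barrier_maximum (fun z => c * g z)%C (fun z => z) (-1) r (1 - r) z1)
      as (z & Hz & Hle).
    - lra.
    - lra.
    - intros z Hz. split; [apply holomorphic_punctured_continuous; [exact Hcg | unfold unit_disc; lra] |].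
      apply continuous_id.
    - intros z Hz0 Hz. split; [apply Hcg; [exact Hz0 | unfold unit_disc; lra] |].
      exists (RtoC 1). apply is_derive_C_AbsRing, (is_derive_id (K := C_AbsRing)).
    - now intros z w _ _.
    - assert (Hz2 := Cmod_ge_0 z). destruct Hz as [Hz | Hz]; [lra |].
      rewrite Ec in Hle. change (Re (RtoC (Cmod (g z1)))) with (Cmod (g z1)) in Hle.
      assert (HR := re_le_Cmod (c * g z)%C). rewrite Cmod_mult, Hc in HR.
      apply Rabs_le_between in HR.
      assert (Hgz : Cmod (g z) <= / r).
      { assert (H := Hb z ltac:(lra)). rewrite Hz in H.
        apply (Rmult_le_reg_l r); [lra |]. rewrite Rinv_r by lra. exact H. }
      assert (0 <= (1 - r) * Cmod z1 ^ 2) by (apply Rmult_le_pos; [lra | apply pow2_ge_0]).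
      assert ((1 - r) * Cmod z ^ 2 <= (1 - r) * 1) by (apply Rmult_le_compat_l; [lra | rewrite Hz; nra]).
      lra. }
  apply Rnot_lt_le. intros Hlt.
  set (d := Cmod (g z1) - 1).
  (* For [r >= 3/4] one has [/ r <= 1 + 2 * (1 - r)], so [Hr] gives an excess over 1 of at most
     [3 * (1 - r) <= 3 * d / 4], less than [d]. *)
  set (r := Rmax ((Cmod z1 + 1) / 2) (Rmax (1 - d / 4) (3 / 4))).
  assert (R1 : (Cmod z1 + 1) / 2 <= r) by apply Rmax_l.
  assert (R2 : 1 - d / 4 <= r) by (eapply Rle_trans; [apply Rmax_l | apply Rmax_r]).
  assert (R3 : 3 / 4 <= r) by (eapply Rle_trans; [apply Rmax_r | apply Rmax_r]).
  assert (Hd : 0 < d) by (unfold d; lra).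
  assert (R4 : r < 1) by (apply Rmax_lub_lt; [lra | apply Rmax_lub_lt; lra]).
  specialize (Hr r ltac:(lra)).
  assert (/ r <= 1 + 2 * (1 - r)).
  { apply (Rmult_le_reg_l r); [lra |]. rewrite Rinv_r by lra. nra. }
  unfold d in *. lra.
Qed.

(* The disc centred at [z0] with radius [|z0|] touches the origin without
   containing it: rigidity on that disc propagates to [g 0] by continuity, and
   from there to the unit disc. *)
Lemma schwarz_rigidity (g : C -> C) (z0 : C) :
  holomorphic_punctured g -> (forall z, unit_disc z -> Cmod (g z) <= 1) ->
  z0 <> 0 -> Cmod z0 < 1 / 2 -> Cmod (g z0) = 1 ->
  exists c : C, Cmod c = 1 /\ forall z, unit_disc z -> (c * g z)%C = RtoC 1.
Proof.
  intros Hg Hb Hz0 Hhalf H1. unfold unit_disc in *.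
  assert (Hm : 0 < Cmod z0) by now apply Cmod_gt_0.
  destruct (Cmod_rotate (g z0)) as (c & Hc & Ec). rewrite H1 in Ec.
  assert (Hcg := holomorphic_punctured_Cscal c g Hg).
  exists c. split; [exact Hc |].
  assert (Hle : forall z, Cmod z < 1 -> Cmod (c * g z) <= 1).
  { intros z Hz. rewrite Cmod_mult, Hc, Rmult_1_l. now apply Hb. }
  assert (HRe : forall z, Cmod z < 1 -> Re (c * g z)%C <= 1).
  { intros z Hz. eapply Rle_trans; [apply Rle_abs |].
    eapply Rle_trans; [apply re_le_Cmod | now apply Hle]. }
  assert (HD : forall z, Cmod (z - z0) < Cmod z0 -> Re (c * g z)%C = 1).
  { intros z Hz.
    assert (Hin : forall w, Cmod (w - z0) < Cmod z0 -> w <> 0 /\ Cmod w < 1).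
    { intros w Hw. split.
      - intros ->. replace (0 - z0)%C with (- z0)%C in Hw by ring. rewrite Cmod_opp in Hw. lra.
      - assert (T := Cmod_triangle_rev z0 w). lra. }
    rewrite (Re_max_at_center_const (fun z => c * g z)%C z0 (Cmod z0)); [now rewrite Ec | | | | exact Hz].
    - intros w Hw. destruct (Hin w) as [Hw0 Hw1]; [lra |]. now apply Hcg.
    - apply holomorphic_punctured_continuous; [exact Hcg | unfold unit_disc; lra].
    - intros w Hw. rewrite Ec. apply HRe. now apply Hin. }
  assert (H0 : Re (c * g 0)%C = 1).
  { apply cond_eq. intros eps Heps.
    destruct (proj1 (continuous_Cmod_R _ _) (continuous_Re _ _ (proj1 Hcg)) eps Heps)
      as (d & Hd & Hcont).
    (* The points [t * z0] with [0 < t < 1] lie in the disc about [z0] and tend to the origin. *)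
    set (t := Rmin (1 / 2) (d / 2)).
    assert (T1 : t <= 1 / 2) by apply Rmin_l. assert (T2 : t <= d / 2) by apply Rmin_r.
    assert (T3 : 0 < t) by (apply Rmin_pos; lra).
    rewrite Rabs_minus_sym, <- (HD (RtoC t * z0)%C).
    - apply Hcont. replace (RtoC t * z0 - 0)%C with (RtoC t * z0)%C by ring.
      rewrite Cmod_mult, Cmod_R, Rabs_pos_eq by lra. nra.
    - replace (RtoC t * z0 - z0)%C with (RtoC (t - 1) * z0)%C by (rewrite RtoC_minus; ring).
      rewrite Cmod_mult, Cmod_R, Rabs_left by lra. nra. }
  intros z Hz. apply Re_eq_1_Cmod_le_1; [now apply Hle |].
  rewrite <- H0. apply (Re_max_at_center_const (fun z => c * g z)%C 0 1).
  - intros w Hw. replace (w - 0)%C with w in Hw by ring.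
    apply Hcg; [apply Cmod_gt_0; lra | unfold unit_disc; lra].
  - apply Hcg.
  - intros w Hw. replace (w - 0)%C with w in Hw by ring. rewrite H0. now apply HRe.
  - now replace (z - 0)%C with z by ring.
Qed.

(* The barrier [eps / |z|^2] is strictly subharmonic and decreases strictly in
   [|z|], as in the proof of Hopf's boundary lemma. *)
Lemma hopf_bound (g : C -> C) :
  holomorphic_punctured g -> (forall z, unit_disc z -> Cmod (g z) <= 1) ->
  (forall z, Cmod z = 1 / 4 -> Cmod (g z) < 1) ->
  exists eps : R, 0 < eps /\
    forall z, 1 / 4 <= Cmod z < 1 -> Cmod (g z) <= 1 - eps * (1 - Cmod z).
Proof.
  intros Hg Hb Hin. unfold unit_disc in *.
  destruct (extreme_value_C (fun z => 1 / 4 <= Cmod z <= 1 / 4) (1 / 4)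
    (fun z => Cmod (g z)) (RtoC (1 / 4))) as (zm & Hzm & Hmax).
  - apply closed_annulus.
  - intros z Hz. lra.
  - intros z Hz. apply continuous_Cmod_comp, holomorphic_punctured_continuous;
      [exact Hg | unfold unit_disc; lra].
  - rewrite Cmod_R, Rabs_pos_eq; lra.
  - assert (Hm := Hin zm ltac:(lra)).
    (* On [|z| = 1/4] the barrier equals [16 * eps], exactly the gap between 1 and the maximum of
       [|g|] there; the sum is thus at most 1 on the inner circle. *)
    set (eps := (1 - Cmod (g zm)) / 16). exists eps.
    assert (Heps : 0 < eps) by (unfold eps; lra). split; [exact Heps |].
    intros z1 Hz1. destruct (Cmod_rotate (g z1)) as (c & Hc & Ec).
    assert (Hcg := holomorphic_punctured_Cscal c g Hg).
    assert (Hinv : forall z, 0 < Cmod z -> Cmod (/ z) ^ 2 = / Cmod z ^ 2).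
    { intros z Hz. rewrite Cmod_inv by now apply Cmod_gt_0. apply pow_inv. }
    assert (Hr : forall r, Cmod z1 < r < 1 -> Cmod (g z1) + eps * / Cmod z1 ^ 2 <= 1 + eps * / r ^ 2).
    { intros r Hr.
      destruct (barrier_maximum (fun z => c * g z)%C Cinv (1 / 4) r eps z1) as (z & Hz & Hle).
      - exact Heps.
      - lra.
      - intros z Hz. split; [apply holomorphic_punctured_continuous; [exact Hcg | unfold unit_disc; lra] |].
        apply ex_derive_C_continuous, ex_derive_Cinv, Cmod_gt_0. lra.
      - intros z Hz0 Hz. split; [apply Hcg; [exact Hz0 | unfold unit_disc; lra] |].
        now apply ex_derive_Cinv.
      - intros z w Hz Hw E.
        assert (Nz : z <> 0) by (apply Cmod_gt_0; lra).
        assert (Nw : w <> 0) by (apply Cmod_gt_0; lra).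
        replace z with (w * (/ w * z))%C by (field; exact Nw).
        rewrite <- E. field. exact Nz.
      - rewrite Ec in Hle. change (Re (RtoC (Cmod (g z1)))) with (Cmod (g z1)) in Hle.
        rewrite (Hinv z1) in Hle by lra.
        assert (HR := re_le_Cmod (c * g z)%C). rewrite Cmod_mult, Hc in HR.
        apply Rabs_le_between in HR.
        assert (Hr2 : 1 <= / r ^ 2).
        { rewrite <- Rinv_1. apply Rinv_le_contravar; [apply pow_lt; lra | nra]. }
        assert (eps * 1 <= eps * / r ^ 2) by (apply Rmult_le_compat_l; lra).
        rewrite (Hinv z) in Hle by lra.
        destruct Hz as [Hz | Hz]; rewrite Hz in Hle.
        + assert (Hzm' := Hmax z ltac:(lra)). simpl in Hzm'.
          replace (eps * / (1 / 4) ^ 2) with (1 - Cmod (g zm)) in Hle by (unfold eps; field).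
          lra.
        + assert (Hgz := Hb z ltac:(lra)). lra. }
    assert (Hlim : Cmod (g z1) + eps * / Cmod z1 ^ 2 <= 1 + eps).
    { apply Rnot_lt_le. intros Hlt.
      assert (Hcont : continuous (fun r => 1 + eps * / r ^ 2) 1).
      { apply (@ex_derive_continuous R_AbsRing R_NormedModule). auto_derive. lra. }
      destruct (Hcont (fun y => y < Cmod (g z1) + eps * / Cmod z1 ^ 2)) as [d Hd].
      - apply open_lt. replace (1 + eps * / 1 ^ 2) with (1 + eps) by field. exact Hlt.
      - set (r := Rmax ((Cmod z1 + 1) / 2) (1 - d / 2)).
        assert (R1 : (Cmod z1 + 1) / 2 <= r) by apply Rmax_l.
        assert (R2 : 1 - d / 2 <= r) by apply Rmax_r.
        assert (Hd0 := cond_pos d).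
        assert (R4 : r < 1) by (apply Rmax_lub_lt; lra).
        assert (Hball := Hd r). specialize (Hr r ltac:(lra)).
        enough (1 + eps * / r ^ 2 < Cmod (g z1) + eps * / Cmod z1 ^ 2) by lra.
        apply Hball. change (Rabs (r - 1) < d). apply Rabs_def1; lra. }
    (* With [t = |z1|], this is [1 - t^2 (2 - t) = (1 - t)(1 + t (1 - t)) >= 0]; it turns the
       barrier into a bound linear in [1 - t]. *)
    assert (Hz2 : 2 - Cmod z1 <= / Cmod z1 ^ 2).
    { assert (0 < Cmod z1 ^ 2) by (apply pow_lt; lra).
      apply (Rmult_le_reg_r (Cmod z1 ^ 2)); [assumption |]. rewrite Rinv_l by lra.
      assert (0 <= (1 - Cmod z1) * (1 + Cmod z1 * (1 - Cmod z1)))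
        by (apply Rmult_le_pos; [| assert (0 <= Cmod z1 * (1 - Cmod z1)) by (apply Rmult_le_pos; lra)]; lra).
      lra. }
    assert (eps * (2 - Cmod z1) <= eps * / Cmod z1 ^ 2) by (apply Rmult_le_compat_l; lra).
    nra.
Qed.

(** At [z = r b], [|fb - f z| >= 1 - r (1 - eps (1 - r)) = (1 - r)(1 + eps r)] while
    [|z - b| = 1 - r]; keeping [r >= 1/2] gives the constant [eps / 2]. The case [eps = 0] is
    allowed and yields the weak inequality. *)
Lemma disc_derivative_lower_bound (f : C -> C) (b fb d : C) (eps : R) :
  Cmod b = 1 -> Cmod fb = 1 -> is_derive_disc f b fb d -> 0 <= eps ->
  (forall z, 1 / 4 <= Cmod z < 1 -> Cmod (f z) <= Cmod z * (1 - eps * (1 - Cmod z))) ->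
  1 + eps / 2 <= Cmod d.
Proof.
  intros Hb Hfb Hd Heps Hf. apply Rnot_lt_le. intros Hlt.
  assert (HN : within unit_disc (@locally C_UniformSpace b)
    (fun z => Cmod ((f z - fb) / (z - b) - d)%C < 1 + eps / 2 - Cmod d)).
  { apply (Hd (fun q => Cmod (q - d)%C < 1 + eps / 2 - Cmod d)). apply locally_Cmod.
    exists (1 + eps / 2 - Cmod d). split; [lra | now intros w]. }
  apply locally_Cmod in HN. destruct HN as (delta & Hdelta & HN).
  set (r := Rmax (1 / 2) (1 - delta / 2)).
  assert (R1 : 1 / 2 <= r) by apply Rmax_l. assert (R2 : 1 - delta / 2 <= r) by apply Rmax_r.
  assert (R3 : r < 1) by (apply Rmax_lub_lt; lra).
  set (z := (RtoC r * b)%C).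
  assert (Hz : Cmod z = r) by (unfold z; rewrite Cmod_mult, Cmod_R, Hb, Rabs_pos_eq; lra).
  assert (Hzb : Cmod (z - b)%C = 1 - r).
  { unfold z. replace (RtoC r * b - b)%C with (RtoC (r - 1) * b)%C by (rewrite RtoC_minus; ring).
    rewrite Cmod_mult, Cmod_R, Hb, Rabs_left; lra. }
  assert (Hne : (z - b)%C <> 0) by (apply Cmod_gt_0; lra).
  specialize (HN z ltac:(lra) ltac:(unfold unit_disc; lra)).
  assert (T := Cmod_triangle_rev d ((f z - fb) / (z - b))%C).
  rewrite Cmod_div, Hzb in T by exact Hne.
  assert (T2 := Cmod_triangle_rev (f z) fb).
  replace (fb - f z)%C with (- (f z - fb))%C in T2 by ring. rewrite Cmod_opp, Hfb in T2.
  specialize (Hf z ltac:(lra)). rewrite Hz in Hf.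
  assert (HQ : 1 + eps / 2 <= Cmod (f z - fb)%C / (1 - r)).
  { apply Rle_div_r; [lra |].
    assert (0 <= eps * ((1 - r) * (r - 1 / 2)))
      by (apply Rmult_le_pos; [exact Heps | apply Rmult_le_pos; lra]).
    lra. }
  lra.
Qed.

(** The value of [g] at 0 is [f'(0)], so continuity of [g] there is differentiability of [f] at
    0. *)
Lemma holomorphic_punctured_quotient (f : C -> C) :
  analytic_on unit_disc f -> f (RtoC 0) = RtoC 0 ->
  exists g : C -> C, holomorphic_punctured g /\ forall z, f z = (z * g z)%C.
Proof.
  intros Hf H0.
  destruct (Hf (RtoC 0)) as [l Hl]; [unfold unit_disc; rewrite Cmod_0; lra |].
  exists (fun z => if Ceq_dec z 0 then l else (f z * / z)%C). split; [split |].
  - apply continuous_Cmod_C. intros eps Heps.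
    destruct (proj1 (is_derive_Cmod f 0 l) Hl (eps / 2) ltac:(lra)) as (d & Hd & H).
    exists d. split; [exact Hd |]. intros w Hw.
    destruct (Ceq_dec 0 0) as [_ | N]; [| now destruct N].
    destruct (Ceq_dec w 0) as [-> | Nw].
    + replace (l - l)%C with (RtoC 0) by ring. now rewrite Cmod_0.
    + specialize (H w Hw). rewrite H0 in H.
      replace (f w - 0 - (w - 0) * l)%C with (w * (f w * / w - l))%C in H by (field; exact Nw).
      replace (w - 0)%C with w in H by ring. rewrite Cmod_mult in H.
      assert (Hm : 0 < Cmod w) by now apply Cmod_gt_0.
      enough (Cmod (f w * / w - l)%C <= eps / 2) by lra.
      apply (Rmult_le_reg_l (Cmod w)); [exact Hm |]. lra.
  - intros z Nz Hz.
    apply (ex_derive_ext_loc (fun z => f z * / z)%C).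
    + apply locally_C, locally_Cmod. exists (Cmod z). split; [now apply Cmod_gt_0 |].
      intros w Hw. destruct (Ceq_dec w 0) as [-> |]; [| reflexivity].
      replace (0 - z)%C with (- z)%C in Hw by ring. rewrite Cmod_opp in Hw. lra.
    + apply ex_derive_Cmult; [now apply Hf | now apply ex_derive_Cinv].
  - intros z. destruct (Ceq_dec z 0) as [-> | Nz]; [rewrite H0; ring | field; exact Nz].
Qed.

Theorem corollary1 :
  forall (f : C -> C),
    analytic_on unit_disc f ->
    (forall z : C, unit_disc z -> Cmod (f z) < 1) ->
    f (RtoC 0) = RtoC 0 ->
    forall b fb f'b : C,
      Cmod b = 1 ->
      is_lim_disc f b fb ->
      Cmod fb = 1 ->
      is_derive_disc f b fb f'b ->
      Cmod f'b >= 1 /\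
      (~ (exists alpha : R,
            forall z : C, unit_disc z -> f z = (Cexp (Ci * RtoC alpha) * z)%C) ->
       Cmod f'b > 1).
Proof.
  intros f Hf Hf1 Hf0 b fb d Hb _ Hfb Hd.
  destruct (holomorphic_punctured_quotient f Hf Hf0) as (g & Hg & Efg).
  assert (Hg1 : forall z, unit_disc z -> Cmod (g z) <= 1).
  { apply schwarz_bound; [exact Hg |]. intros z Hz.
    rewrite <- Cmod_mult, <- Efg. now apply Rlt_le, Hf1. }
  assert (Hbound : forall eps, 0 <= eps ->
    (forall z, 1 / 4 <= Cmod z < 1 -> Cmod (g z) <= 1 - eps * (1 - Cmod z)) ->
    1 + eps / 2 <= Cmod d).
  { intros eps Heps H. apply (disc_derivative_lower_bound f b fb); try assumption.
    intros z Hz. rewrite Efg, Cmod_mult. apply Rmult_le_compat_l; [lra | now apply H]. }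
  split.
  - apply Rle_ge. enough (1 + 0 / 2 <= Cmod d) by lra. apply Hbound; [lra |].
    intros z Hz. rewrite Rmult_0_l, Rminus_0_r. apply Hg1. unfold unit_disc. lra.
  - intros Hrot.
    destruct (hopf_bound g Hg Hg1) as (eps & Heps & H).
    (* If [|g z0| = 1] on the circle [|z| = 1/4], rigidity gives [f z = z / c] with [|c| = 1], a
       rotation whose angle [alpha] is an argument of [/ c]. *)
    + intros z0 Hz0. destruct (Hg1 z0 ltac:(unfold unit_disc; lra)) as [| E]; [assumption |].
      exfalso. apply Hrot.
      destruct (schwarz_rigidity g z0 Hg Hg1) as (c & Hc & Hcg);
        [apply Cmod_gt_0; lra | lra | exact E |].
      assert (Nc : c <> 0) by (apply Cmod_gt_0; lra).
      destruct (Cexp_surjective (/ c)%C) as (x & alpha & Ec).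
      { apply Cmod_gt_0. rewrite Cmod_inv, Hc by exact Nc. lra. }
      assert (Hx : x = 0).
      { apply exp_inv. rewrite <- (Cmod_Cexp x alpha), <- Ec, Cmod_inv, Hc, exp_0 by exact Nc.
        apply Rinv_1. }
      exists alpha. intros z Hz.
      replace (Ci * RtoC alpha)%C with ((0, alpha) : C)
        by (unfold Ci, RtoC, Cmult; simpl; f_equal; ring).
      rewrite <- Hx, <- Ec, Efg.
      replace (g z) with (/ c * (c * g z))%C by (field; exact Nc).
      rewrite Hcg by exact Hz. ring.
    + assert (H' := Hbound eps (Rlt_le _ _ Heps) H). lra.
Qed.
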